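(* Let $s,k,q$ be positive integers and define $h(t)=h_{s,k}(t)=\sum_{\deg Y\le k-1}\sum_{\deg Z\le s-1}E(tYZ)$ for $t\in\mathbb{P}$, where $Y,Z$ range over $\mathbb{F}_2[T]$. Then for every $t\in\mathbb{P}$, $$h(t)=2^{k+s-r(D_{s\times k}(t))},$$ and $$\int_{\mathbb{P}}h^{q}(t)\,dt=2^{(q-1)(k+s)+1}\sum_{i=0}^{s}\Gamma_i^{s\times k}2^{-qi}.$$ Moreover, if $R$ denotes the number of tuples $(Y_1,Z_1,\ldots,Y_q,Z_q)$ of polynomials in $\mathbb{F}_2[T]$ with $\deg Y_i\le k-1$, $\deg Z_i\le s-1$ ($1\le i\le q$) satisfying $Y_1Z_1+Y_2Z_2+\cdots+Y_qZ_q=0$, then $R=\int_{\mathbb{P}}h^{q}(t)\,dt$.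
   Context: $\mathbb{K}=\mathbb{F}_2((T^{-1}))$ is the field of formal Laurent series $t=\sum_{i\ge -n}\alpha_iT^{-i}$ ($\alpha_i\in\mathbb{F}_2$) with $|t|=2^{\deg t}$. $\mathbb{P}=\{t\in\mathbb{K}:|t|<1\}=\{\sum_{i\ge1}\alpha_iT^{-i}\}$ is the unit interval, with Haar measure $dt$ normalized so that $\int_{\mathbb{P}}dt=1$ (i.e. the coefficients $\alpha_1,\alpha_2,\dots$ are independent uniform bits). $E:\mathbb{K}\to\{\pm1\}$ is the character $E(t)=(-1)^{\alpha_1}$, $\alpha_1$ being the coefficient of $T^{-1}$ in $t$. The zero polynomial has degree $-\infty$, so degree bounds include $0$. For $t=\sum_{i\ge1}\alpha_iT^{-i}\in\mathbb{P}$ and positive integers $a,b$, $D_{a\times b}(t)$ is the $a\times b$ persymmetric (Hankel) matrix $(\alpha_{i+j-1})_{1\le i\le a,1\le j\le b}$ over $\mathbb{F}_2$; $r(\cdot)$ is rank over $\mathbb{F}_2$. $\Gamma_i^{a\times b}$ is the number of $a\times b$ persymmetric matrices over $\mathbb{F}_2$ (matrices $(\alpha_{i+j-1})$, $(\alpha_1,\dots,\alpha_{a+b-1})\in\mathbb{F}_2^{a+b-1}$) of rank $i$. *)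

(* Defs.v *)
From HB Require Import structures.
From mathcomp Require Import all_boot all_order all_algebra.
From mathcomp Require Import all_classical all_reals all_analysis.
From mathcomp Require Import zify.

Set Implicit Arguments.
Unset Strict Implicit.
Unset Printing Implicit Defensive.
Import Order.TTheory GRing.Theory Num.Theory.

Local Open Scope classical_set_scope.
Local Open Scope ring_scope.

(* An element of F_2((T^-1)); [lcoef t i] is the coefficient of T^i, i : int,
   and only finitely many coefficients with i >= 0 are nonzero. *)
Record laurent := Laurent {
  lcoef : int -> 'F_2;
  _ : exists n : int, forall i, n <= i -> lcoef i = 0 }.

(* deg t < n, i.e. |t| < 2^n *)
Definition deg_lt (t : laurent) (n : int) : Prop :=
  forall i, n <= i -> lcoef t i = 0.

Lemma deg_ltP (t : laurent) : exists n, deg_lt t n.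
Proof. by case: t. Qed.

Lemma deg_ltW (t : laurent) (m n : int) : m <= n -> deg_lt t m -> deg_lt t n.
Proof. by move=> mn tm i ni; apply: tm; exact: le_trans ni. Qed.

Lemma laurentP (t u : laurent) : (forall i, lcoef t i = lcoef u i) -> t = u.
Proof.
case: t u => [f pf] [g pg] /= fg.
have e : f = g by apply/funext.
by subst g; congr Laurent; exact: Prop_irrelevance.
Qed.

HB.instance Definition _ := gen_eqMixin laurent.
HB.instance Definition _ := gen_choiceMixin laurent.

Section LaurentRing.
Implicit Types t u v : laurent.

Fact laurent0_subproof : exists n : int, forall i, n <= i -> (0 : 'F_2) = 0.
Proof. by exists 0. Qed.
Definition laurent0 := @Laurent (fun=> 0) laurent0_subproof.

Fact laurent1_subproof :
  exists n : int, forall i, n <= i -> ((i == 0)%:R : 'F_2) = 0.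
Proof. by exists 1 => i; case: eqP => // ->. Qed.
Definition laurent1 := @Laurent (fun i => (i == 0)%:R) laurent1_subproof.

Fact lopp_subproof t : exists n : int, forall i, n <= i -> - lcoef t i = 0.
Proof. by have [n tn] := deg_ltP t; exists n => i /tn ->; rewrite oppr0. Qed.
Definition lopp t := Laurent (lopp_subproof t).

Fact ladd_subproof t u :
  exists n : int, forall i, n <= i -> lcoef t i + lcoef u i = 0.
Proof.
have [m tm] := deg_ltP t; have [n un] := deg_ltP u.
exists (Num.max m n) => i; rewrite ge_max => /andP[/tm -> /un ->].
by rewrite addr0.
Qed.
Definition ladd t u := Laurent (ladd_subproof t u).

Fact lmul_subproof t u : exists n : int, forall i, n <= i ->
  \sum_(j \in [set: int]) (lcoef t j * lcoef u (i - j)) = 0.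
Proof.
have [m tm] := deg_ltP t; have [n un] := deg_ltP u.
exists (m + n) => i le_i; apply: fsbig1 => j _.
have [/tm ->|jm] := leP m j; first by rewrite mul0r.
by rewrite un ?mulr0//; lia.
Qed.
(* Cauchy product; the sum has finite support. *)
Definition lmul t u := Laurent (lmul_subproof t u).

Lemma laddA : associative ladd.
Proof. by move=> t u v; apply/laurentP => i /=; rewrite addrA. Qed.
Lemma laddC : commutative ladd.
Proof. by move=> t u; apply/laurentP => i /=; rewrite addrC. Qed.
Lemma ladd0 : left_id laurent0 ladd.
Proof. by move=> t; apply/laurentP => i /=; rewrite add0r. Qed.
Lemma laddN : left_inverse laurent0 lopp ladd.
Proof. by move=> t; apply/laurentP => i /=; rewrite addNr. Qed.

HB.instance Definition _ := GRing.isZmodule.Build laurent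
  laddA laddC ladd0 laddN.

Lemma lcoef_lmul t u (m n i : int) (l : nat) :
  deg_lt t m -> deg_lt u n -> m + n - i < l%:Z + 2 ->
  lcoef (lmul t u) i = \sum_(j < l) lcoef t (m - 1 - j%:Z) * lcoef u (i - m + 1 + j%:Z).
Proof.
move=> tm un lt_l /=.
pose h (j : nat) : int := m - 1 - j%:Z.
rewrite -(fsbig_widen (h @` `I_l) setT) //; last first.
  move=> j [_ /= nj]; have [/tm ->|jm] := leP m j; first by rewrite mul0r.
  rewrite un ?mulr0//; rewrite leNgt; apply/negP => ltn; apply: nj.
  exists `|(m - 1 - j)%R|%N; rewrite /h /=; lia.
rewrite fsbig_image; last by move=> a b _ _; rewrite /h; lia.
rewrite -fsbig_ord; apply: eq_bigr => j _; congr (_ * lcoef u _).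
rewrite /h; lia.
Qed.

Lemma lmulC : commutative lmul.
Proof.
move=> t u; apply/laurentP => i /=.
rewrite (reindex_fsbigT (fun j : int => i - j)) /=; last first.
  by exists (fun j => i - j) => j; lia.
apply: eq_fsbigr => j _; rewrite mulrC; congr (lcoef u _ * _); lia.
Qed.

Lemma lmulA : associative lmul.
Proof.
move=> t u v; apply/laurentP => i.
have [a ta] := deg_ltP t; have [b ub] := deg_ltP u; have [c vc] := deg_ltP v.
have dM x y p q : deg_lt x p -> deg_lt y q -> deg_lt (lmul x y) (p + q - 1).
  move=> xp yq j lej; rewrite (@lcoef_lmul _ _ p q _ 0) ?big_ord0//; lia.
have [l ll] : exists l : nat, a + b + c - i < l%:Z + 1 by exists `|(a + b + c - i)%R|%N; lia.
rewrite (@lcoef_lmul _ _ a (b + c - 1) _ l) //; [|exact: dM|lia].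
rewrite (@lcoef_lmul _ _ (a + b - 1) c _ l) //; [|exact: dM|lia].
under [RHS]eq_bigr => j _.
  rewrite (@lcoef_lmul _ _ a b _ l) //; [|have := ltn_ord j; lia]; rewrite big_distrl; over.
rewrite exchange_big; apply: eq_bigr => j _.
rewrite (@lcoef_lmul _ _ (b + j%:Z) c _ l) //; last lia.
  rewrite big_distrr /=; apply: eq_bigr => k _; rewrite -mulrA.
  congr (_ * (lcoef u _ * lcoef v _)); lia.
by apply: deg_ltW ub; lia.
Qed.

Lemma lmul1 : left_id laurent1 lmul.
Proof.
move=> t; apply/laurentP => i; have [n tn] := deg_ltP t.
have d1 : deg_lt laurent1 1 by move=> j /=; case: eqP => // ->.
rewrite (@lcoef_lmul _ _ 1 n i (`|(n - i)%R|%N).+1) //; last lia.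
rewrite big_ord_recl big1 ?addr0 => [|j _].
  by rewrite mul1r; congr (lcoef t _); lia.
have /negbTE e : 1 - 1 - (lift ord0 j)%:Z != 0 :> int by rewrite lift0; lia.
by rewrite {1}/lcoef {1}/laurent1 e mul0r.
Qed.

Lemma lmulDl : left_distributive lmul ladd.
Proof.
move=> t u v; apply/laurentP => i.
have [a ta] := deg_ltP t; have [b ub] := deg_ltP u; have [c vc] := deg_ltP v.
pose m := Num.max a b.
have tm : deg_lt t m by apply: deg_ltW ta; rewrite le_max lexx.
have um : deg_lt u m by apply: deg_ltW ub; rewrite le_max lexx orbT.
have dm : deg_lt (ladd t u) m by move=> j mj /=; rewrite tm// um// addr0.
have lt_l : m + c - i < `|(m + c - i)%R|%N%:Z + 2 by lia.
change (lcoef (lmul (ladd t u) v) i =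
  lcoef (lmul t v) i + lcoef (lmul u v) i).
rewrite (lcoef_lmul dm vc lt_l) (lcoef_lmul tm vc lt_l) (lcoef_lmul um vc lt_l).
by rewrite -big_split /=; apply: eq_bigr => j _; rewrite mulrDl.
Qed.

Lemma laurent1_neq0 : laurent1 != 0.
Proof. by apply/eqP => /(congr1 (lcoef^~ 0)). Qed.

HB.instance Definition _ := GRing.Zmodule_isComNzRing.Build laurent
  lmulA lmulC lmul1 lmulDl laurent1_neq0.
HB.instance Definition _ := isPointed.Build laurent 0.

End LaurentRing.

Fact laurent_of_poly_subproof (p : {poly 'F_2}) : exists n : int, forall i,
  n <= i -> (if i is Posz j then p`_j else 0) = 0.
Proof.
by exists (size p)%:Z => -[j|//]; rewrite lez_nat => /(nth_default 0).
Qed.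
Definition laurent_of_poly (p : {poly 'F_2}) : laurent :=
  Laurent (laurent_of_poly_subproof p).


Definition unit_interval : set laurent := [set t | deg_lt t 0].

(* The open ball {u | |u - t| < 2^-n}; these balls generate the topology. *)
Definition lball (t : laurent) (n : int) : set laurent :=
  [set u | deg_lt (u - t) (- n)].

Definition lopen : set (set laurent) :=
  [set U | forall t, U t -> exists n, lball t n `<=` U].

(* F_2((T^-1)) with its Borel sigma-algebra *)
Notation borel_laurent := (g_sigma_algebraType lopen).

(* Translation invariance together with the normalization mu(P) = 1
   (P being a compact open subgroup) characterizes the Haar measure. *)
Definition normalized_haar (R : realType)
    (mu : {measure set borel_laurent -> \bar R}) : Prop :=
  (forall (x : laurent) (A : set borel_laurent), measurable A ->
     mu [set x + a | a in A] = mu A) /\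
  mu unit_interval = 1%E.

Section Character.
Variable R : realType.

Definition Echar (t : laurent) : R := (-1) ^+ (lcoef t (-1) : nat).

Definition hsum (s k : nat) (t : laurent) : R :=
  \sum_(Y : {poly_k 'F_2}) \sum_(Z : {poly_s 'F_2})
    Echar (t * laurent_of_poly Y * laurent_of_poly Z).

End Character.

(* The persymmetric matrix (alpha_(i+j-1)) with 1 <= i <= a and 1 <= j <= b;
   matrix indices start at 0 in the library. *)
Definition persym (a b : nat) (alpha : nat -> 'F_2) : 'M['F_2]_(a, b) :=
  \matrix_(i < a, j < b) alpha (i + j + 1)%N.

Definition Dmx (a b : nat) (t : laurent) : 'M['F_2]_(a, b) :=
  persym a b (fun i => lcoef t (- i%:Z)).

(* The tuple (alpha_1, ..., alpha_(a+b-1)) is indexed from 0. *)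
Definition Gamma (a b i : nat) : nat :=
  #|[set M in [set persym a b (fun m => nth 0 al m.-1)
                 | al : (a + b).-1.-tuple 'F_2] | \rank M == i]%SET|.

Definition num_solutions (s k q : nat) : nat :=
  #|[set w : {ffun 'I_q -> {poly_k 'F_2} * {poly_s 'F_2}} |
      \sum_(i < q) ((w i).1 : {poly 'F_2}) * ((w i).2 : {poly 'F_2}) == 0]%SET|.

(* A normalized Haar measure exists: take the image of the Lebesgue measure on
   [0, +oo[ by the binary expansion sum_i a_i 2^i |-> sum_i a_i T^i. *)
Section HaarExistence.

Lemma bits_exist (l : nat) (f : nat -> 'F_2) :
  (forall j, (l <= j)%N -> f j = 0) ->
  exists m, forall j, f j = (m %/ 2 ^ j)%:R.
Proof.
elim: l f => [|l IH] f fl; first by exists 0%N => j; rewrite fl// div0n.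
have [j lj|m mP] := IH (fun j => f j.+1); first exact: fl.
exists (m * 2 + f 0%N)%N => -[|j].
  have e2 : 2%:R = 0 :> 'F_2 by exact/eqP.
  by rewrite expn0 divn1 natrD natrM natr_Zp e2 mulr0 add0r.
rewrite mP expnS divnMA; congr ((_ %/ _)%:R).
by rewrite divnMDl // divn_small ?addn0// ltn_ord.
Qed.

Lemma bits_inj (m m' : nat) :
  (forall j, (m %/ 2 ^ j)%:R = (m' %/ 2 ^ j)%:R :> 'F_2) -> m = m'.
Proof.
have [l] := ubnP (m + m')%N; elim: l m m' => // l IH m m' ml mm'.
have e0 : (m %% 2 = m' %% 2)%N.
  have := mm' 0%N; rewrite !expn0 !divn1 => /(congr1 val) /=.
  by rewrite !val_Fp_nat.
have [e|mm0] := posnP (m + m')%N; first by lia.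
rewrite (divn_eq m 2) (divn_eq m' 2) e0; congr (_ * _ + _)%N.
by apply: IH => [|j]; [lia|rewrite -!divnMA -!expnS].
Qed.

Variable R : realType.
Implicit Types x y : R.

Lemma truncn_div2 y j : Num.truncn (y / 2 ^+ j) = (Num.truncn y %/ 2 ^ j)%N.
Proof.
have p0 : 0 < 2 ^+ j :> R by rewrite exprn_gt0.
have [y0|y0] := ltP y 0.
  have t0 z : z < 0 -> Num.truncn z = 0%N :> nat.
    by move=> z0; apply/truncn0Pn; rewrite lt_geF // (lt_trans z0).
  by rewrite !t0 ?div0n// pmulr_llt0// invr_gt0.
apply: truncn_def; have /andP[y1 y2] := truncn_itv y0.
rewrite ler_pdivlMr// ltr_pdivrMr// -natrX -!natrM.
rewrite (le_trans _ y1) ?ler_nat ?leq_divM//=.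
by rewrite (lt_le_trans y2)// ler_nat -ltn_divLR ?expn_gt0.
Qed.

Fact dyadic_subproof x :
  exists n : int, forall i, n <= i -> (Num.truncn (x * 2 ^ (- i)))%:R = 0 :> 'F_2.
Proof.
exists (Num.truncn x).+1%:Z => -[j|//]; rewrite lez_nat => xj.
rewrite -exprnN truncn_div2 divn_small // (leq_trans xj) //.
by rewrite ltnW // ltn_expl.
Qed.
Definition dyadic x : laurent := Laurent (dyadic_subproof x).

Lemma lcoef_dyadic x (n : int) (j : nat) :
  lcoef (dyadic x) (j%:Z - n) = (Num.truncn (x * 2 ^ n) %/ 2 ^ j)%:R.
Proof.
by rewrite /= opprB expfzDr ?pnatr_eq0// mulrA -exprnN truncn_div2.
Qed.

Lemma lballP t n u :
  lball t n u <-> forall j : nat, lcoef u (j%:Z - n) = lcoef t (j%:Z - n).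
Proof.
split=> [tu j|tu i ni].
  by apply/eqP; rewrite -subr_eq0; apply/eqP/tu; lia.
have -> : i = `|(i + n)%R|%N%:Z - n by lia.
by apply/eqP; rewrite subr_eq0; apply/eqP/tu.
Qed.

Lemma lball_dyadic t n : exists m : nat,
  forall x, lball t n (dyadic x) <-> Num.truncn (x * 2 ^ n) = m.
Proof.
have [N tN] := deg_ltP t.
have [j lj|m mP] := @bits_exist `|(N + n)%R|%N (fun j => lcoef t (j%:Z - n)).
  by apply: tN; lia.
exists m => x; split=> [/lballP tx|xm]; last first.
  by apply/lballP => j; rewrite lcoef_dyadic xm.
by apply: bits_inj => j; rewrite -lcoef_dyadic -mP.
Qed.

Lemma lball_dyadic_itv t n : exists m : nat,
  dyadic @^-1` lball t n `&` `[0, +oo[ =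
  `[(m%:R / 2 ^ n : R), (m.+1%:R / 2 ^ n)[%classic.
Proof.
have [m mP] := lball_dyadic t n; exists m.
have p0 : 0 < 2 ^ n :> R by rewrite exprz_gt0.
apply/seteqP; split=> x /=; rewrite !in_itv/= ?andbT.
  move=> [/mP <- x0]; rewrite ler_pdivrMr// ltr_pdivlMr//.
  by apply: truncn_itv; rewrite mulr_ge0// ltW.
move=> /andP[]; rewrite ler_pdivrMr// ltr_pdivlMr// => xm mx; split.
  by apply/mP/truncn_def; rewrite xm.
by rewrite -(pmulr_lge0 _ p0) (le_trans _ xm)// ler0n.
Qed.

Lemma lball_center t n u : lball t n u -> lball t n = lball u n.
Proof.
move=> /lballP tu; apply/seteqP; split=> v /lballP hv; apply/lballP => j.
  by rewrite hv tu.
by rewrite hv tu.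
Qed.

Lemma lball_refl t n : lball t n t.
Proof. exact/lballP. Qed.

Lemma lball_countable t n : exists m : nat, lball t n = lball (dyadic (m%:R / 2 ^ n)) n.
Proof.
have [m mP] := lball_dyadic t n; exists m; apply: lball_center; apply/mP.
by rewrite divfK ?natrK// gt_eqF// exprz_gt0.
Qed.

Lemma lball_sub t (m n : int) : m <= n -> lball t n `<=` lball t m.
Proof. by move=> mn u; apply: deg_ltW; rewrite lerN2. Qed.

Definition lballs : set (set laurent) :=
  [set A | A = set0 \/ exists t n, A = lball t n].

Lemma lball_open t n : lopen (lball t n).
Proof. by move=> u /lball_center ->; exists n. Qed.

Lemma measurable_laurentE : (@measurable _ borel_laurent) = <<s lballs >>.
Proof.
apply/seteqP; split; apply: smallest_sub => //=; try exact: smallest_sigma_algebra.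
- move=> U oU.
  pose F (p : nat) : set laurent := if unpickle p is Some (m, n) then
     let B := lball (dyadic (m%:R / 2 ^ n%:Z)) n%:Z in
     if `[< B `<=` U >] then B else set0 else set0.
  have -> : U = \bigcup_p F p.
    apply/seteqP; split=> [t Ut|t [p _]].
      have [n nU] := oU _ Ut; pose n' := `|n|%N.
      have [m e] := lball_countable t n'%:Z.
      exists (pickle (m, n')) => //; rewrite /F pickleK -e.
      case: asboolP => [_|]; first exact: lball_refl.
      by case; apply: subset_trans nU; apply: lball_sub; rewrite /n'; lia.
    rewrite /F; case: unpickle => [[m n]|//].
    by case: asboolP => // /[apply].
  apply: sigma_algebra_bigcup => p; apply: sub_gen_smallest.
  rewrite /F; case: unpickle => [[m n]|]; last by left.
  by case: asboolP => _; [right; do 2 eexists|left].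
- move=> A [->|[t [n ->]]]; first exact: sigma_algebra0.
  by apply: sub_gen_smallest; exact: lball_open.
Qed.

Lemma lball_measurable t n : measurable (lball t n : set borel_laurent).
Proof. by apply: sub_gen_smallest; exact: lball_open. Qed.

Lemma setI_closed_lballs : setI_closed lballs.
Proof.
move=> A B [->|[t [m ->]]]; first by rewrite set0I; left.
move=> [->|[u [n ->]]]; first by rewrite setI0; left.
have [->|/set0P[v [tv uv]]] := eqVneq (lball t m `&` lball u n) set0; first by left.
right; exists v; rewrite (lball_center tv) (lball_center uv).
have [mn|/ltW nm] := leP m n.
  by exists n; apply/setIidPr/lball_sub.
by exists m; apply/setIidPl/lball_sub.
Qed.

Lemma dyadic_measurable :
  measurable_fun [set: measurableTypeR R] (dyadic : R -> borel_laurent).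
Proof.
apply: (@measurability _ _ (measurableTypeR R) borel_laurent _ _ _
          measurable_laurentE) => _ [_ [->|[t [n ->]]] <-].
  by rewrite preimage_set0 setI0.
have [m mP] := lball_dyadic t n.
rewrite setTI -(setIT (_ @^-1` _)) -(setUv `[(0:R), +oo[%classic) setIUr.
have [m' ->] := lball_dyadic_itv t n.
apply: measurableU; first exact: measurable_itv.
have -> : dyadic @^-1` lball t n `&` ~` `[0, +oo[ =
    (if m == 0%N then `]-oo, (0:R)[%classic else set0).
  rewrite setCitvr; apply/seteqP; split=> x /=; rewrite in_itv/=.
    move=> [/mP <- x0]; rewrite (_ : Num.truncn _ = 0%N) /= ?in_itv//.
    by apply/truncn0Pn; rewrite lt_geF// (@lt_trans _ _ 0)// pmulr_llt0// exprz_gt0.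
  case: eqP => // m0; rewrite /= in_itv /= => x0; split=> //; apply/mP.
  by rewrite m0; apply/truncn0Pn; rewrite lt_geF// (@lt_trans _ _ 0)// pmulr_llt0// exprz_gt0.
by case: ifP.
Qed.

Let m0 : measurable (`[0, +oo[%classic : set (measurableTypeR R)).
Proof. exact: measurable_itv. Qed.

Let haar : {measure set borel_laurent -> \bar R} :=
  measure_function_pushforward__canonical__measure_function_Measure (mrestr lebesgue_measure m0) dyadic_measurable.

Lemma haar_lball t n : haar (lball t n) = (2 ^ (- n))%:E.
Proof.
rewrite /haar /= /pushforward /mrestr.
have [m ->] := lball_dyadic_itv t n.
have p0 : 0 < 2 ^ n :> R by rewrite exprz_gt0.
rewrite lebesgue_measure_itv /= lte_fin ltr_pM2r ?invr_gt0// ltr_nat ltnSn.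
by rewrite -EFinB -mulrBl -natrB// subSnn mul1r invr_expz.
Qed.

Lemma translate_measurable (x : laurent) :
  measurable_fun setT ((fun u : laurent => u - x) : borel_laurent -> borel_laurent).
Proof.
apply: (@measurability _ _ borel_laurent borel_laurent _ _ lopen) => //.
move=> _ [U oU <-]; rewrite setTI; apply: sub_gen_smallest => t /= Ut.
have [n nU] := oU _ Ut; exists n => u tu; apply: nU.
by rewrite /lball /= opprB addrA subrK.
Qed.

Lemma normalized_haar_exists :
  exists mu : {measure set borel_laurent -> \bar R}, normalized_haar mu.
Proof.
exists haar; split; last first.
  rewrite (_ : unit_interval = lball 0 0) ?haar_lball ?oppr0 ?expr0z//.
  by apply/seteqP; split=> t; rewrite /lball /= subr0.
move=> x A mA.
have preE (B : set laurent) : [set x + a | a in B] = (fun u : laurent => u - x) @^-1` B.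
  apply/seteqP; split=> [_ [b Bb <-]|y By] /=; first by rewrite addrAC subrr add0r.
  by exists (y - x) => //; rewrite addrC subrK.
pose nu : {measure set borel_laurent -> \bar R} :=
  measure_function_pushforward__canonical__measure_function_Measure haar (translate_measurable x).
rewrite preE -[LHS]/(nu A).
apply/esym; refine (@measure_unique _ R borel_laurent lballs
  (fun k => lball 0 (- k%:Z)) _ _ _ _ haar nu _ _ A mA).
- exact: measurable_laurentE.
- exact: setI_closed_lballs.
- by move=> k; right; do 2 eexists.
- apply/seteqP; split=> // t _; have [n tn] := deg_ltP t.
  exists `|n|%N => //; rewrite /lball /= subr0 opprK; apply: deg_ltW tn; lia.
- move=> B [->|[t [n ->]]]; first by rewrite !measure0.
  rewrite haar_lball -(haar_lball (t + x) n) /nu /= /pushforward.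
  congr (lebesgue_measure (_ `&` _)); apply/seteqP; split=> y /=.
    by rewrite /lball /= opprD addrA addrAC.
  by rewrite /lball /= opprD addrA addrAC.
- by move=> k; rewrite haar_lball ltry.
Qed.

End HaarExistence.

(* Main.v *)
(** [E(tYZ)] is the sign of the bilinear form of [D_(s x k)(t)] at the coefficient
vectors of [Z] and [Y].  Summing over [Y] kills every [Z] outside the left kernel
of the matrix, so [h(t) = 2^k 2^(s - rank)].  Hence [h] only depends on the first
[n = s + k - 1] coefficients of [t]; the cylinders they determine are translates of
each other and have measure [2^-n], which turns the integral of [h^q] into an
average over ['F_2^n].  Sorting by rank gives the formula with [Gamma]; expanding
[h^q] into characters [E(t(Y_1 Z_1 + ... + Y_q Z_q))] and using their orthogonality
gives the number of solutions. *)
Require Import Defs.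
From mathcomp Require Import all_boot all_order all_algebra.
From mathcomp Require Import all_classical all_reals all_analysis.
From mathcomp Require Import measurable_realfun mxabelem zify lra.

Set Implicit Arguments.
Unset Strict Implicit.
Unset Printing Implicit Defensive.
Import Order.TTheory GRing.Theory Num.Theory.

Local Open Scope classical_set_scope.
Local Open Scope ring_scope.

(** * Multiplying Laurent series by polynomials *)

Lemma lcoef_mul_poly (t : laurent) (p : {poly 'F_2}) (n : nat) (i : int) :
  (size p <= n)%N ->
  lcoef (t * laurent_of_poly p) i = \sum_(j < n) p`_j * lcoef t (i - j%:Z).
Proof.
move=> pn; rewrite [t * _]mulrC.
rewrite -[LHS]/(\sum_(j \in [set: int])
  (lcoef (laurent_of_poly p) j * lcoef t (i - j))).
rewrite -(fsbig_widen (Posz @` `I_n) setT) //; last first.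
  move=> [j|j] [_ /= nj]; last by rewrite mul0r.
  rewrite nth_default ?mul0r// (leq_trans pn)// leqNgt.
  by apply/negP => jn; apply: nj; exists j.
by rewrite fsbig_image -?fsbig_ord// => a b _ _ [].
Qed.

Lemma laurent_of_polyM (p r : {poly 'F_2}) :
  laurent_of_poly (p * r) = laurent_of_poly p * laurent_of_poly r.
Proof.
apply/laurentP => i.
(* This bound is at least [size r] and exceeds i, so the convolution up to i sits inside the sum;
   the other terms read [p] at negative exponents, where it is zero. *)
pose n := (size r + (`|i|%N).+1)%N.
rewrite (@lcoef_mul_poly _ _ n) ?leq_addr//.
case: i @n => [i|i] n /=; last first.
  by rewrite big1 // => j _; rewrite (_ : Negz i - j%:Z = Negz (i + j)) ?mulr0//; lia.
rewrite coefMr (big_ord_widen n (fun j => p`_(i - j) * r`_j)); last by rewrite /n; lia.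
rewrite [RHS](bigID (fun j : 'I_n => (j < i.+1)%N)) /=.
rewrite [X in _ = _ + X]big1 ?addr0 => [|j nj]; last first.
  by rewrite (_ : i%:Z - j%:Z = Negz (j - i).-1) ?mulr0//; lia.
apply: eq_bigr => j ji; rewrite mulrC (_ : i%:Z - j%:Z = Posz (i - j)) //; lia.
Qed.

(** * Signs of bits and orthogonality of characters *)

Section BinarySign.
Variable R : realType.
Implicit Types (x y : 'F_2).

Definition sgnF2 x : R := (-1) ^+ (x : nat).

Lemma sgnF2_0 : sgnF2 0 = 1. Proof. by []. Qed.
Lemma sgnF2_1 : sgnF2 1 = -1. Proof. by []. Qed.

Lemma sgnF2D x y : sgnF2 (x + y) = sgnF2 x * sgnF2 y.
Proof.
by rewrite /sgnF2 -exprD -[RHS]signr_odd /= -modn2.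
Qed.

Lemma sgnF2_sum (I : Type) (r : seq I) (P : pred I) (F : I -> 'F_2) :
  sgnF2 (\sum_(i <- r | P i) F i) = \prod_(i <- r | P i) sgnF2 (F i).
Proof. exact: (big_morph _ sgnF2D sgnF2_0). Qed.

Lemma card_F2 : #|'F_2| = 2%N. Proof. by rewrite card_Fp. Qed.

Lemma sum_sgnF2_dot n (x : 'rV['F_2]_n) :
  \sum_(y : 'rV['F_2]_n) sgnF2 (\sum_(i < n) x 0 i * y 0 i) =
  if x == 0 then 2 ^+ n else 0.
Proof.
case: eqP => [->|/eqP/rV0Pn[j xj]].
  rewrite (eq_bigr (fun=> 1)) => [|y _]; last first.
    by rewrite big1// => i _; rewrite mxE mul0r.
  by rewrite sumr_const card_mx card_F2 mul1n natrX.
have {}xj : x 0 j = 1.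
  by case: (x 0 j) xj => -[|[|]]// lt2 _; apply/val_inj.
(* Translating y by the basis vector e_j, where x_j = 1, flips the sign of every term. *)
set S := (LHS); suff : S = - S by move=> SN; lra.
rewrite {1}/S (reindex_inj (addIr (delta_mx 0 j))) -sumrN.
apply: eq_bigr => y _; rewrite -mulN1r -sgnF2_1 -sgnF2D; congr sgnF2.
under eq_bigr do rewrite mxE mulrDr.
rewrite big_split addrC; congr (_ + _).
rewrite (bigD1 j)//= mxE !eqxx xj mulr1 big1 ?addr0// => i /negbTE ij.
by rewrite mxE ij andbF mulr0.
Qed.

End BinarySign.

(** * Evaluation of h through the rank *)

Section Rank.
Variable R : realType.
Variables s k : nat.

Lemma EcharE (t : laurent) (p : {poly 'F_2}) n : (size p <= n)%N ->
  Echar R (t * laurent_of_poly p) =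
  sgnF2 R (\sum_(j < n) p`_j * lcoef t (- j.+1%:Z)).
Proof.
move=> pn; congr sgnF2; rewrite (lcoef_mul_poly _ _ pn).
apply: eq_bigr => j _; congr (_ * lcoef t _); lia.
Qed.

Lemma sum_npoly (n : nat) (F : 'rV['F_2]_n -> R) :
  \sum_(Y : {poly_n 'F_2}) F (\row_(i < n) (Y : {poly 'F_2})`_i) = \sum_y F y.
Proof.
rewrite [RHS](reindex (@npoly_rV 'F_2 n)) //.
by exists (@rVnpoly 'F_2 n) => x _; [exact: npoly_rV_K|exact: rVnpolyK].
Qed.

(** The left kernel is the row space of [kermx M], of dimension s - rank M. *)
Lemma card_left_kernel (M : 'M['F_2]_(s, k)) :
  #|[set z : 'rV_s | z *m M == 0]%SET| = (2 ^ (s - \rank M))%N.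
Proof.
rewrite -mxrank_ker -[RHS](_ : #|rowg (kermx M)| = _); last first.
  by rewrite card_rowg card_F2.
apply: eq_card => z.
by rewrite inE mem_rowg; apply/eqP/sub_kermxP.
Qed.

Lemma hsum_rank (t : laurent) :
  hsum R s k t = 2 ^+ (k + s - \rank (Dmx s k t)).
Proof.
pose B (y : 'rV['F_2]_k) (z : 'rV_s) :=
  sgnF2 R (\sum_(i < k) (z *m Dmx s k t) 0 i * y 0 i).
transitivity (\sum_y \sum_z B y z).
  (* With i and j counted from 0, the T^-1 coefficient of tYZ is the sum of Z_j Y_i
     alpha_(i+j+1). *)
  rewrite -sum_npoly; apply: eq_bigr => Y _; rewrite -sum_npoly.
  apply: eq_bigr => Z _; rewrite (EcharE _ (size_npoly _)); congr sgnF2.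
  under eq_bigr => j _ do
    rewrite (lcoef_mul_poly _ _ (size_npoly _)) big_distrr/=.
  rewrite exchange_big; apply: eq_bigr => i _ /=.
  rewrite !mxE big_distrl/=; apply: eq_bigr => j _.
  by rewrite !mxE mulrA mulrAC; congr (_ * lcoef t _ * _); lia.
(* For fixed z, the sum over y is 2^k if z is in the left kernel and 0 otherwise. *)
rewrite exchange_big /=.
under eq_bigr do rewrite sum_sgnF2_dot.
rewrite -big_mkcond /= sumr_const.
rewrite -[X in _ *+ X](_ : #|[set z : 'rV_s | z *m Dmx s k t == 0]%SET| = _).
  by rewrite card_left_kernel -[LHS]mulr_natr natrX -exprD addnBA// rank_leq_row.
by apply: eq_card => z; rewrite inE.
Qed.

End Rank.

(** * Cylinders and integration of functions of finitely many digits *)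

Section Cylinders.
Variable n : nat.
Implicit Types (t : laurent) (a : 'rV['F_2]_n).

Definition lbits t : 'rV['F_2]_n := \row_i lcoef t (- i.+1%:Z).

(** [Negz j] stands for -(j+1), so a_j becomes the coefficient of T^-(j+1); [insub] fails for j >=
    n, which gives 0 there. *)
Fact lseries_subproof a : exists m : int, forall i, m <= i ->
  (if i is Negz j then oapp (a 0) 0 (insub j) else 0) = 0.
Proof. by exists 0 => -[]. Qed.
Definition lseries a := Laurent (lseries_subproof a).

Lemma lcoef_lseries a (i : 'I_n) : lcoef (lseries a) (- i.+1%:Z) = a 0 i.
Proof. by rewrite /= valK. Qed.

(** The ball fixes the coefficients at exponents j - n, j natural: for j >= n they vanish, which is
    membership in the unit interval, and for j < n they are the n leading digits. *)
Lemma lball_lseries a t :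
  lball (lseries a) n t <-> unit_interval t /\ lbits t = a.
Proof.
split=> [/lballP ta|[t0 <-]].
  split=> [[i|//] _|].
    by have := ta (i + n)%N; rewrite (_ : (i + n)%:Z - n%:Z = i)//; lia.
  apply/rowP => i; rewrite mxE -lcoef_lseries.
  have -> : - i.+1%:Z = (n - i.+1)%:Z - n%:Z by have := ltn_ord i; lia.
  exact: ta.
apply/lballP => j; have [nj|jn] := leqP n j.
  have -> : j%:Z - n%:Z = (j - n)%N by lia.
  exact: t0.
have lt_n : (n - j.+1 < n)%N by lia.
have -> : j%:Z - n%:Z = - (Ordinal lt_n).+1%:Z by rewrite /=; lia.
by rewrite lcoef_lseries mxE.
Qed.

Variable R : realType.
Variable mu : {measure set borel_laurent -> \bar R}.
Hypothesis haar : normalized_haar mu.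

(** The ball about t is the translate by t of the ball about 0. *)
Lemma haar_lballE t : mu (lball t n) = mu (lball 0 n).
Proof.
rewrite -(haar.1 t (lball 0 n) (lball_measurable _ _)); congr (mu _).
apply/seteqP; split=> [u tu|_ [u u0 <-]].
  by exists (u - t); [rewrite /lball /= subr0|rewrite addrC subrK].
by move: u0; rewrite /lball /= subr0 addrAC subrr add0r.
Qed.

Lemma unit_interval_measurable : measurable (unit_interval : set borel_laurent).
Proof.
rewrite (_ : unit_interval = lball 0 0); first exact: lball_measurable.
by apply/seteqP; split=> t; rewrite /lball /= subr0.
Qed.

(** The common measure of the cylinders stays as a factor: the case g = 1 then determines it. *)
Lemma integral_lbits_lball (g : 'rV['F_2]_n -> R) : (forall a, 0 <= g a) ->
  (\int[mu]_(t in unit_interval) (g (lbits t))%:E =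
   (\sum_a g a)%:E * mu (lball 0%R n))%E.
Proof.
move=> g0; pose B a : set borel_laurent := lball (lseries a) n.
(* Each t of the unit interval lies in exactly one cylinder, the one indexed by [lbits t]. *)
transitivity (\int[mu]_(t in unit_interval) \sum_a (g a * \1_(B a) t)%:E)%E.
  apply: eq_integral => t /set_mem Pt.
  rewrite sumEFin (bigD1 (lbits t))//= big1 => [|a ta].
    rewrite addr0 indicE mem_set ?mulr1//; exact/lball_lseries.
  rewrite indicE memNset ?mulr0// => /lball_lseries[_ e].
  by rewrite e eqxx in ta.
have mB a : measurable (B a) by exact: lball_measurable.
rewrite ge0_integral_sum //=; first last.
- by move=> a t _; rewrite lee_fin mulr_ge0.
- move=> a; apply/measurable_EFinP; exact: measurable_funM.
- exact: unit_interval_measurable.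
rewrite -sumEFin ge0_sume_distrl; last by move=> a _; rewrite lee_fin.
apply: eq_bigr => a _.
rewrite (@integralZl_indic _ _ _ mu _ unit_interval_measurable (fun=> B a)) //.
  rewrite integral_indic //; last exact: unit_interval_measurable.
  rewrite setIidl ?[mu (B a)]haar_lballE//.
  by move=> t /lball_lseries[].
by rewrite ltNge g0.
Qed.

Lemma haar_lball0 : mu (lball 0 n) = (2 ^- n)%:E.
Proof.
have := @integral_lbits_lball (fun=> 1) (fun=> ler01).
rewrite integral_cst; last exact: unit_interval_measurable.
have -> : mu unit_interval = 1%E := haar.2.
have n0 : 0 < 2 ^+ n :> R by rewrite exprn_gt0.
rewrite mule1 sumr_const card_mx card_F2 mul1n natrX.
(* The equation is now 1 = 2^n times the measure, which also excludes infinite values. *)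
case: (mu _) => [r| |] /=.
- by rewrite -EFinM => -[/esym e]; congr EFin; apply: (mulfI (negbT (gt_eqF n0))); rewrite mulfV ?gt_eqF.
- by rewrite gt0_muley// lte_fin.
- by rewrite gt0_muleNy// lte_fin.
Qed.

Lemma integral_lbits (g : 'rV['F_2]_n -> R) : (forall a, 0 <= g a) ->
  (\int[mu]_(t in unit_interval) (g (lbits t))%:E =
   (2 ^- n * \sum_a g a)%:E)%E.
Proof. by move=> /integral_lbits_lball ->; rewrite haar_lball0 -EFinM mulrC. Qed.

End Cylinders.

(** * Averages of h^q: counting by rank and counting solutions *)

Section Counting.
Variable R : realType.
Variables s k q : nat.
Let n := (s + k).-1.

Lemma DmxE t i j : Dmx s k t i j = lcoef t (- (i + j).+1%:Z).
Proof. by rewrite mxE addn1. Qed.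

Lemma Dmx_lseries_lbits t : Dmx s k (lseries (lbits n t)) = Dmx s k t.
Proof.
apply/matrixP => i j; rewrite !DmxE.
have lt_n : (i + j < n)%N by rewrite /n; have := ltn_ord i; have := ltn_ord j; lia.
by rewrite (lcoef_lseries _ (Ordinal lt_n)) mxE.
Qed.

Lemma Dmx_lseries_inj : (0 < s)%N -> (0 < k)%N ->
  injective (fun a : 'rV['F_2]_n => Dmx s k (lseries a)).
Proof.
move=> s0 k0 a b /matrixP ab; apply/rowP => m.
(* Every m < s + k - 1 splits as a row index min(m, s-1) plus a column index, so each digit occurs
   as a matrix entry. *)
have lt_s : (minn m s.-1 < s)%N by lia.
have lt_k : (m - minn m s.-1 < k)%N by have := ltn_ord m; rewrite /n; lia.
have := ab (Ordinal lt_s) (Ordinal lt_k); rewrite !DmxE.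
have -> : (Ordinal lt_s + Ordinal lt_k = m)%N by rewrite /=; lia.
by rewrite !lcoef_lseries.
Qed.

Lemma Gamma_lseries i : (0 < s)%N -> (0 < k)%N ->
  Gamma s k i = #|[set a : 'rV['F_2]_n | \rank (Dmx s k (lseries a)) == i]%SET|.
Proof.
move=> s0 k0; rewrite -(card_imset _ (Dmx_lseries_inj s0 k0)).
have persymE (al : n.-tuple 'F_2) :
    persym s k (fun m => nth 0 al m.-1) = Dmx s k (lseries (\row_i tnth al i)).
  apply/matrixP => u v; rewrite DmxE mxE addn1.
  have lt_n : (u + v < n)%N by rewrite /n; have := ltn_ord u; have := ltn_ord v; lia.
  by rewrite (lcoef_lseries _ (Ordinal lt_n)) mxE (tnth_nth 0).
apply: eq_card => M; rewrite inE; apply/andP/imsetP.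
  move=> [/imsetP[al _ ->] rk]; exists (\row_i tnth al i); last exact: persymE.
  by rewrite inE -persymE.
move=> [a]; rewrite inE => rk ->; split=> //; apply/imsetP.
exists [tuple a 0 i | i < n] => //; rewrite persymE; congr (Dmx _ _ (lseries _)).
by apply/rowP => j; rewrite mxE tnth_mktuple.
Qed.

Lemma sum_hsum_Gamma : (0 < s)%N -> (0 < k)%N ->
  \sum_(a : 'rV['F_2]_n) hsum R s k (lseries a) ^+ q =
  \sum_(0 <= i < s.+1) (Gamma s k i)%:R * 2 ^+ (q * (k + s - i)).
Proof.
move=> s0 k0; rewrite big_mkord.
(* The rank is at most s, so [inord] does not alter it. *)
rewrite (partition_big (fun a => inord (\rank (Dmx s k (lseries a))) : 'I_s.+1) xpredT)//=.
apply: eq_bigr => i _; rewrite Gamma_lseries// -sum1_card natr_sum big_distrl/=.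
apply: eq_big => [a|a /eqP <-].
  by rewrite inE -(inj_eq val_inj) /= inordK// ltnS rank_leq_row.
by rewrite hsum_rank inordK ?ltnS ?rank_leq_row// -exprM mulnC mul1r.
Qed.

(** The degree is at most (k-1) + (s-1), so E(tYZ) reads only the first n digits of t. *)
Lemma size_npolyM (Y : {poly_k 'F_2}) (Z : {poly_s 'F_2}) :
  (size ((Y : {poly 'F_2}) * (Z : {poly 'F_2}))%R <= n)%N.
Proof.
apply: leq_trans (size_polyMleq _ _) _.
by have := size_npoly Y; have := size_npoly Z; rewrite /n; lia.
Qed.

Lemma size_sum_npolyM (w : {ffun 'I_q -> {poly_k 'F_2} * {poly_s 'F_2}}) :
  (size (\sum_(i < q) ((w i).1 : {poly 'F_2}) * ((w i).2 : {poly 'F_2}))%R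
   <= n)%N.
Proof.
apply: leq_trans (size_sum _ _ _) _.
by apply/bigmax_leqP => i _; exact: size_npolyM.
Qed.

Lemma hsum_exp (t : laurent) :
  hsum R s k t ^+ q =
  \sum_(w : {ffun 'I_q -> {poly_k 'F_2} * {poly_s 'F_2}})
    Echar R (t * laurent_of_poly
      (\sum_(i < q) ((w i).1 : {poly 'F_2}) * ((w i).2 : {poly 'F_2}))).
Proof.
(* The q-th power is a product of q equal sums over pairs (Y, Z); distributing it gives a sum over
   all tuples w. *)
rewrite /hsum pair_bigA/= -[in LHS](card_ord q) -prodr_const bigA_distr_bigA.
apply: eq_bigr => w _.
rewrite (EcharE _ _ (size_sum_npolyM w)).
under eq_bigr => i _ do
  rewrite -mulrA -laurent_of_polyM (EcharE _ _ (size_npolyM _ _)).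
rewrite -sgnF2_sum exchange_big; congr sgnF2; apply: eq_bigr => j _.
by rewrite -big_distrl coef_sum.
Qed.

Lemma sum_hsum_num_solutions :
  \sum_(a : 'rV['F_2]_n) hsum R s k (lseries a) ^+ q =
  2 ^+ n * (num_solutions s k q)%:R.
Proof.
under eq_bigr do rewrite hsum_exp.
rewrite exchange_big /num_solutions -sum1_card natr_sum big_distrr/=.
rewrite [RHS]big_mkcond; apply: eq_bigr => w _; rewrite inE mulr1.
set P := \sum_(i < q) _.
have szP : (size P <= n)%N := size_sum_npolyM w.
(* Since [P] has at most n coefficients, orthogonality on n-bit vectors detects exactly whether it
   is zero. *)
have -> : (P == 0) = (\row_(i < n) P`_i == 0).
  apply/eqP/eqP => [->|/rowP P0]; first by apply/rowP => i; rewrite !mxE coef0.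
  apply/polyP => i; rewrite coef0; have [ni|lt_n] := leqP n i.
    by rewrite nth_default// (leq_trans szP).
  by have := P0 (Ordinal lt_n); rewrite !mxE.
rewrite -sum_sgnF2_dot; apply: eq_bigr => a _; rewrite (EcharE _ _ szP).
by congr sgnF2; apply: eq_bigr => i _; rewrite lcoef_lseries mxE.
Qed.

End Counting.

(** * From averages over n-bit vectors to the integral *)

Theorem theorem1p4 (R : realType) (s k q : nat)
    (hs : (0 < s)%N) (hk : (0 < k)%N) (hq : (0 < q)%N) :
  (forall t : laurent, unit_interval t ->
     hsum R s k t = 2 ^+ (k + s - \rank (Dmx s k t))%N) /\
  (forall mu : {measure set borel_laurent -> \bar R}, normalized_haar mu ->
     (\int[mu]_(t in unit_interval) ((hsum R s k t) ^+ q)%:E =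
        (2 ^+ ((q - 1) * (k + s) + 1)%N *
         \sum_(0 <= i < s.+1) (Gamma s k i)%:R * 2 ^- (q * i)%N)%:E)%E /\
     ((num_solutions s k q)%:R%:E =
        \int[mu]_(t in unit_interval) ((hsum R s k t) ^+ q)%:E)%E).
Proof.
split=> [t _|mu haar]; first exact: hsum_rank.
pose n := (s + k).-1.
(* The matrix uses only the first n digits of t, so h^q factors through [lbits]. *)
have intE : (\int[mu]_(t in unit_interval) ((hsum R s k t) ^+ q)%:E =
    (2 ^- n * \sum_(a : 'rV['F_2]_n) hsum R s k (lseries a) ^+ q)%:E)%E.
  rewrite -(integral_lbits haar (g := fun a => hsum R s k (lseries a) ^+ q)).
    by apply: eq_integral => t _; rewrite !hsum_rank Dmx_lseries_lbits.
  by move=> a; rewrite hsum_rank exprn_ge0// exprn_ge0.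
have n0 : 2 ^+ n != 0 :> R by rewrite expf_neq0// pnatr_eq0.
split; rewrite intE; congr EFin; last first.
  by rewrite sum_hsum_num_solutions mulKf.
rewrite sum_hsum_Gamma// !big_distrr /= !big_nat; apply: eq_bigr => i /andP[_ lis].
rewrite mulrCA [RHS]mulrCA; congr (_ * _).
(* Clearing 2^n and then 2^(qi) reduces the claim to q(k+s-i) + qi = n + (q-1)(k+s) + 1, where n + 1
   = k + s. *)
apply: (mulfI n0); rewrite mulrA mulfV// mul1r mulrA -exprD.
have qi0 : 2 ^+ (q * i) != 0 :> R by rewrite expf_neq0// pnatr_eq0.
rewrite -[LHS](mulfK qi0) -exprD; congr (2 ^+ _ * _).
(* These inequalities keep the natural-number subtractions from truncating. *)
have := mulnBr q (k + s) i; have : (q * i <= q * (k + s))%N.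
  by rewrite leq_mul2l; lia.
by rewrite mulnBl mul1n /n; have : (k + s <= q * (k + s))%N; [rewrite leq_pmull|lia].
Qed.
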